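(* Let $m,n$ be integers with $m+n\ge 0$. The number of $KT$-paths from $(-2m,-2m)$ to $(2n,2n)$ is $a_{m+n}$.
   Context: $a_k=\frac1{2k+1}\binom{3k}{k}$. Paths are finite sequences of points (vertices) of $\mathbb Z^2$; steps are differences of consecutive vertices. An $H_2$-path has steps $(2,0),(0,1)$; a $V_2$-path has steps $(1,0),(0,2)$; a $T$-path has steps $(2,0),(1,1),(0,2)$. A $KT$-path is a path $P$ such that: (1) $P$ never goes above the diagonal (all vertices satisfy $y\le x$); (2) the part of $P$ to the left of the line $x=0$ is a $V_2$-path; (3) the part of $P$ in the fourth quadrant is a $T$-path; (4) the part of $P$ above the line $y=0$ is an $H_2$-path. Some parts may be empty, and consecutive parts meet at a vertex on the separating line. Precisely, all vertices satisfy $y\le x$, and each step from a vertex $(x,y)$ satisfies: if $x<0$, the step is $(1,0)$ or $(0,2)$; if $x\ge 0$ and $y<0$, the step is $(2,0)$, $(1,1)$ or $(0,2)$ and its endpoint $(x',y')$ has $y'\le 0$; if $x\ge0$ and $y\ge 0$, the step is $(2,0)$ or $(0,1)$. *)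

(* Defs.v *)
From HB Require Import structures.
From mathcomp Require Import all_boot all_order all_algebra.
From mathcomp Require Import boolp classical_sets functions cardinality.
From mathcomp Require Import zify.

Set Implicit Arguments.
Unset Strict Implicit.
Unset Printing Implicit Defensive.

Import Order.TTheory GRing.Theory Num.Theory.

(* The division is exact, by [mul_fuss_catalan] below. *)
Definition fuss_catalan (k : nat) : nat := 'C(3 * k, k) %/ (2 * k + 1).

Lemma mul_fuss_catalan (k : nat) :
  (2 * k + 1) * fuss_catalan k = 'C(3 * k, k).
Proof.
rewrite mulnC; apply: divnK.
have E : (2 * k + 1) * 'C((3 * k).+1, k) = (3 * k).+1 * 'C(3 * k, k).
  by rewrite mul_bin_down; congr (_ * _); lia.
have cop : coprime (2 * k + 1) (3 * k).+1.
  rewrite coprime_sym /coprime -dvdn1; set d := gcdn _ _.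
  have d1 : d %| 2 * (3 * k).+1 by rewrite dvdn_mull // dvdn_gcdl.
  have : d %| 3 * (2 * k + 1) by rewrite dvdn_mull // dvdn_gcdr.
  have -> : 3 * (2 * k + 1) = 2 * (3 * k).+1 + 1 by lia.
  by rewrite dvdn_addr.
by rewrite -(Gauss_dvdr _ cop) -E dvdn_mulr.
Qed.

Local Open Scope ring_scope.

Definition vertex : Type := (int * int)%type.

Definition H2_step (u v : vertex) : bool := v - u \in [:: (2, 0); (0, 1)].
Definition V2_step (u v : vertex) : bool := v - u \in [:: (1, 0); (0, 2)].
Definition T_step (u v : vertex) : bool :=
  v - u \in [:: (2, 0); (1, 1); (0, 2)].

(* The condition [v.2 <= 0] makes the T-part end at a vertex on the line y = 0;
   on the line x = 0 this is automatic, V2-steps having width at most 1. *)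
Definition KT_step (u v : vertex) : bool :=
  if u.1 < 0 then V2_step u v
  else if u.2 < 0 then T_step u v && (v.2 <= 0)
  else H2_step u v.

(* A path is its nonempty list of vertices; [sorted] only relates consecutive
   entries, so it says that each of its steps is a KT-step. *)
Definition KT_path (P : seq vertex) : bool :=
  [&& P != [::], all (fun u : vertex => u.2 <= u.1) P & sorted KT_step P].

Definition joins (A B : vertex) (P : seq vertex) : bool :=
  if P is u :: p then (u == A) && (last u p == B) else false.

(* Main.v *)
Require Import Defs.
From mathcomp Require Import all_boot all_order all_algebra.
From mathcomp Require Import finmap.
From mathcomp Require Import boolp classical_sets functions cardinality.
From mathcomp Require Import zify ring.

(** Let m, n >= 0.  The path is cut where it first meets the line x = 0, at
(0, -2j), and where it last meets the line y = 0, at (2i, 0); each of the three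
pieces has a known generating function.

Let B(z) = 1 + z B(z)^3, so that a_k is the coefficient of z^k in B; more
generally [raney k d] is the coefficient of z^k in B^d.  Let P = w B(w)^2 and
Q = u B(u)^2, where w marks n and u marks m; then B(w) = 1 / (1 - P) and
w = P (1 - P)^2.  A first passage decomposition along the diagonal shows that
the H_2-piece, which starts with a vertical step, is counted by P^i, and the
V_2-piece, which ends with a horizontal step, by Q^j.  The T-piece is counted by
the coefficient of X^(2i) Y^(2j) in 1 / (1 - X^2 - X Y - Y^2), a trinomial
coefficient.  Taking the even part of this fraction, the total is
  G = sum over m, n of N(m, n) u^m w^n = (1 - P - Q) / ((1 - P - Q)^2 - P Q),
and since u - w = (Q - P) ((1 - P - Q)^2 - P Q),
  (u - w) G = (Q - P) (1 - P - Q) = Q (1 - Q) - P (1 - P).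
The right side has no mixed monomial in P and Q, hence none in u and w, so
N(m, n + 1) = N(m + 1, n): the count depends on m + n only, and for m = 0 it
is a_n.

The formal proof works with coefficients: P^i is replaced by its sequence of coefficients
[raney_even ^~ i], and the multiplication by w = P - 2 P^2 + P^3 is the
recurrence [raney_evenS].  The absence of mixed monomials is
[tri_even_swap], a linear identity between trinomial coefficients, and
[glued_shift] is the resulting invariance.  On the combinatorial side,
[num_paths] counts the KT-paths to a fixed endpoint, [num_paths_H2] and
[num_paths_T] solve its recurrence in the first and fourth quadrants, and
[num_paths_column] pushes the starting point through the left half plane.  When
one of m, n is negative only one kind of step occurs and one of these lemmas is
enough. *)

Set Implicit Arguments.
Unset Strict Implicit.
Unset Printing Implicit Defensive.

Import Order.TTheory GRing.Theory Num.Theory.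
Local Open Scope classical_set_scope.
Local Open Scope card_scope.

(** * Coefficients of the powers of the ternary tree series *)

(** The coefficient of z^k in B^d, where B = 1 + z B^3; unfolding the recurrence
B^(e+1) = B^e + z B^(e+3) for e = 0, ..., d - 1 makes the recursion structural
in k. *)
Fixpoint raney (k d : nat) : nat :=
  if k is k'.+1 then \sum_(e < d) raney k' e.+3 else 1.

Lemma raney0 d : raney 0 d = 1. Proof. by []. Qed.

Lemma raneyS0 k : raney k.+1 0 = 0.
Proof. by rewrite /= big_ord0. Qed.

Lemma raneySS k d : raney k.+1 d.+1 = raney k.+1 d + raney k d.+3.
Proof. by rewrite /= big_ord_recr. Qed.

(** An additive form of the closed formula d / (3k + d) 'C(3k + d, k), at k + 1:
both sides obey Pascal's rule, so only d = 0 requires a computation. *)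
Lemma raney_bin k d :
  raney k.+1 d + 2 * 'C(3 * k + d + 2, k) = 'C(3 * k + d + 2, k.+1).
Proof.
elim: k d => [|k IHk] d.
  elim: d => [|d IHd]; first by rewrite raneyS0.
  by rewrite raneySS; move: IHd; rewrite !bin0 !bin1 /=; lia.
elim: d => [|d IHd].
  rewrite raneyS0 add0n addn0.
  have := mul_bin_left (3 * k.+1 + 2) k.+1.
  have -> : 3 * k.+1 + 2 - k.+1 = 2 * k.+2 by lia.
  by rewrite -mulnA mulnCA => /eqP; rewrite eqn_pmul2l // => /eqP.
rewrite raneySS; have := IHk d.+3.
have -> : 3 * k + d.+3 + 2 = 3 * k.+1 + d + 2 by lia.
have -> : 3 * k.+1 + d.+1 + 2 = (3 * k.+1 + d + 2).+1 by lia.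
by move: IHd; set M := 3 * k.+1 + d + 2; rewrite !binS; lia.
Qed.

Lemma raney1 k : raney k 1 = fuss_catalan k.
Proof.
suff E : (2 * k + 1) * raney k 1 = 'C(3 * k, k).
  by move: E; rewrite -mul_fuss_catalan; nia.
case: k => [|k]; first by [].
have := raney_bin k 1; have -> : 3 * k + 1 + 2 = 3 * k.+1 by lia.
have := mul_bin_left (3 * k.+1) k.
have -> : 3 * k.+1 - k = 2 * k.+1 + 1 by lia.
by nia.
Qed.

(** With P = z B^2 the equation of B reads B = 1 + P B, whence B = 1 + P + P^2 +
..., here read at z^k. *)
Lemma raney_sum k : \sum_(i < k.+1) raney (k - i) (2 * i) = raney k 1.
Proof.
(* Multiplying by B^d makes the statement provable by induction on k. *)
suff E d : \sum_(i < k.+1) raney (k - i) (2 * i + d) = raney k d.+1.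
  by rewrite -E; apply: eq_bigr => i _; rewrite addn0.
elim: k d => [|k IHk] d; first by rewrite big_ord1.
rewrite big_ord_recl subn0 muln0 raneySS -IHk; congr (_ + _).
by apply: eq_bigr => i _ /=; congr raney; rewrite /bump; lia.
Qed.

Local Open Scope ring_scope.

(** * Trinomial coefficients *)

(** The coefficient of t^p in (1 + t + t^2)^k: the number of T-paths of k steps
that move p to the right, and hence 2k - p upwards. *)
Fixpoint tri (k : nat) (p : int) : nat :=
  if k is k'.+1 then (tri k' p + tri k' (p - 1) + tri k' (p - 2))%N
  else (p == 0 : nat).

(** With an integer row number, the recurrence of T-paths needs no case
distinction when a vertex lies beyond the endpoint. *)
Definition tri_row (k p : int) : nat := if k is Posz k' then tri k' p else 0%N.

Lemma tri_small k (p : int) : p < 0 -> tri k p = 0%N.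
Proof.
elim: k p => [|k IHk] p p_lt0 /=; first by lia.
by rewrite !IHk //; lia.
Qed.

Lemma tri_large k (p : int) : p > 2 * k%:Z -> tri k p = 0%N.
Proof.
elim: k p => [|k IHk] p p_gt /=; first by lia.
by rewrite !IHk //; lia.
Qed.

Lemma tri_top k : tri k (2 * k%:Z) = 1%N.
Proof.
elim: k => [|k IHk] //=.
rewrite (tri_large (p := 2 * k.+1%:Z)) ?(tri_large (p := 2 * k.+1%:Z - 1)); try lia.
by rewrite -[RHS]IHk; congr tri; lia.
Qed.

Lemma tri_row_small k p : p < 0 -> tri_row k p = 0%N.
Proof. by case: k => // k; apply: tri_small. Qed.

Lemma tri_row_large k p : p > 2 * k -> tri_row k p = 0%N.
Proof. by case: k => // k; apply: tri_large. Qed.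

Lemma tri_rowS k p : k != 0 ->
  tri_row k p =
    (tri_row (k - 1) p + tri_row (k - 1) (p - 1) + tri_row (k - 1) (p - 2))%N.
Proof.
case: k => [[|k]|k] // _.
by have -> : k.+1%:Z - 1 = k%:Z by lia.
Qed.

(** * The sum over the two cutting points depends on m + n only *)

(** The coefficient of z^n in P^i, where P = z B^2. *)
Definition raney_even (n i : nat) : int :=
  if (i <= n)%N then (raney (n - i) (2 * i))%:Z else 0.

Lemma raney_even_large n i : (n < i)%N -> raney_even n i = 0.
Proof. by rewrite /raney_even; case: leqP. Qed.

Lemma raney_evenS0 n : raney_even n.+1 0 = 0.
Proof. by rewrite /raney_even muln0 subn0 raneyS0. Qed.

(** The relation z P^i = P^(i+1) - 2 P^(i+2) + P^(i+3), that is z = P (1 - P)^2. *)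
Lemma raney_evenS n i :
  raney_even n i = raney_even n.+1 i.+1 - 2 * raney_even n.+1 i.+2
                   + raney_even n.+1 i.+3.
Proof.
rewrite /raney_even ltnS; case: (leqP i n) => [le_in|lt_ni]; last first.
  by rewrite !ifF //; lia.
rewrite subSS !mulnS !addSn !add0n.
move: (n - i)%N (subnKC le_in) => k; case: k => [|[|k]] def_n.
- by rewrite !ifF //; lia.
- rewrite ifT ?ifF; try lia.
  have -> : (n.+1 - i.+2)%N = 0%N by lia.
  by rewrite !raneySS !raney0; lia.
rewrite !ifT; try lia.
have -> : (n.+1 - i.+2)%N = k.+1 by lia.
have -> : (n.+1 - i.+3)%N = k by lia.
by rewrite !raneySS; lia.
Qed.

Lemma sum_shift K (f : int -> int) (b : nat -> int) :
  f (- 1) = 0 -> b K = 0 ->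
  \sum_(i < K) f i%:Z * b i.+1 = \sum_(i < K) f (i%:Z - 1) * b i.
Proof.
case: K => [|K] f_1 bK; first by rewrite !big_ord0.
rewrite big_ord_recr big_ord_recl /= bK sub0r f_1 mulr0 mul0r addr0 add0r.
by apply: eq_bigr => i _; rewrite /bump /= add1n; congr (f _ * _); lia.
Qed.

(** The coefficients of P (1 - P)^2 f, for the series f in P whose coefficients
are given. *)
Definition mul_z (f : int -> int) (i : int) : int :=
  f (i - 1) - 2 * f (i - 2) + f (i - 3).

(** For a series f in P, the coefficient of z^n in f is that of z^(n+1) in z f. *)
Lemma sum_raney_even n K (f : int -> int) :
  (n.+1 < K)%N -> (forall i, i < 0 -> f i = 0) ->
  \sum_(i < K) f i%:Z * raney_even n i =
  \sum_(i < K) mul_z f i%:Z * raney_even n.+1 i.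
Proof.
move=> ltnK f_neg.
have shift e : \sum_(i < K) f i%:Z * raney_even n.+1 (i + e) =
    \sum_(i < K) f (i%:Z - e%:Z) * raney_even n.+1 i.
  elim: e f f_neg => [|e IHe] f f_neg.
    by apply: eq_bigr => i _; rewrite addn0 subr0.
  under eq_bigr do rewrite addnS -addSn.
  rewrite (sum_shift (b := fun i => raney_even n.+1 (i + e))); first last.
  - by apply: raney_even_large; lia.
  - exact: f_neg.
  rewrite (IHe (fun i => f (i - 1))); last by move=> i i_lt0; apply: f_neg; lia.
  by apply: eq_bigr => i _; congr (f _ * _); lia.
have := shift 1; have := shift 2; have := shift 3 => E3 E2 E1.
transitivity (\sum_(i < K) f i%:Z * raney_even n.+1 (i + 1)
   - 2 * (\sum_(i < K) f i%:Z * raney_even n.+1 (i + 2))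
   + \sum_(i < K) f i%:Z * raney_even n.+1 (i + 3)).
  rewrite mulr_sumr -sumrB -big_split; apply: eq_bigr => i _ /=.
  by rewrite raney_evenS addn1 addn2 addn3; ring.
rewrite E1 E2 E3 mulr_sumr -sumrB -big_split; apply: eq_bigr => i _ /=.
by rewrite /mul_z; ring.
Qed.

(** The number of T-paths from (0, -2j) to (2i, 0). *)
Definition tri_even (i j : int) : int := (tri_row (i + j) (2 * i))%:Z.

Lemma tri_even_negl (i j : int) : i < 0 -> tri_even i j = 0.
Proof. by move=> i_lt0; rewrite /tri_even tri_row_small //; lia. Qed.

Lemma tri_even_negr (i j : int) : j < 0 -> tri_even i j = 0.
Proof. by move=> j_lt0; rewrite /tri_even tri_row_large //; lia. Qed.

(** The series F of the [tri_even i j] satisfies ((1 - P - Q)^2 - P Q) F =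
1 - P - Q, and Q (1 - Q)^2 - P (1 - P)^2 = (Q - P) ((1 - P - Q)^2 - P Q); so
Q (1 - Q)^2 F and P (1 - P)^2 F differ by (Q - P) (1 - P - Q), which has no
monomial divisible by P Q. *)
Lemma tri_even_swap (i j : int) : 0 < i -> 0 < j ->
  mul_z (tri_even i) j = mul_z (tri_even^~ j) i.
Proof.
move=> i_gt0 j_gt0.
(* For i = j = 1 some of the coefficients lie in the nonexistent row -1; in all
   other cases the identity holds after expansion down to row i + j - 3. *)
have [/eqP ij2|ij_neq2] := boolP (i + j == 2).
  have [-> ->] : i = 1 /\ j = 1 by lia.
  by [].
rewrite /mul_z /tri_even.
have -> : i + (j - 1) = i + j - 1 by lia.
have -> : i + (j - 2) = i + j - 2 by lia.
have -> : i + (j - 3) = i + j - 3 by lia.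
rewrite ![i - _ + j]addrAC.
pose r p := tri_row (i + j - 3) p.
have row2 (p q1 q2 : int) : q1 = p - 1 -> q2 = p - 2 ->
    tri_row (i + j - 2) p = (r p + r q1 + r q2)%N.
  move=> -> ->; rewrite tri_rowS; last by lia.
  by have -> : i + j - 2 - 1 = i + j - 3 by lia.
have row1 (p : int) : tri_row (i + j - 1) p =
    (r p + 2 * r (p - 1)%R + 3 * r (p - 2)%R + 2 * r (p - 3)%R + r (p - 4)%R)%N.
  rewrite tri_rowS; last by lia.
  have -> : i + j - 1 - 1 = i + j - 2 by lia.
  rewrite (row2 p (p - 1) (p - 2)) // (row2 (p - 1) (p - 2) (p - 3)); try lia.
  by rewrite (row2 (p - 2) (p - 3) (p - 4)); lia.
rewrite !row1 -/(r _) -/(r _).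
rewrite (row2 (2 * i) (2 * i - 1) (2 * i - 2)) //.
rewrite (row2 (2 * (i - 2)) (2 * i - 5) (2 * i - 6)); try lia.
have -> : 2 * (i - 1) - 1 = 2 * i - 3 by lia.
have -> : 2 * (i - 1) - 2 = 2 * i - 4 by lia.
have -> : 2 * (i - 1) - 3 = 2 * i - 5 by lia.
have -> : 2 * (i - 1) - 4 = 2 * i - 6 by lia.
have -> : 2 * (i - 1) = 2 * i - 2 by lia.
have -> : 2 * (i - 2) = 2 * i - 4 by lia.
have -> : 2 * (i - 3) = 2 * i - 6 by lia.
move: (r (2 * i)) (r (2 * i - 1)) (r (2 * i - 2)) (r (2 * i - 3)).
by move: (r (2 * i - 4)) (r (2 * i - 5)) (r (2 * i - 6)); lia.
Qed.

(** The number of KT-paths when m, n >= 0, summed over the cutting points (2i, 0)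
and (0, -2j).  Only i <= n and j <= m contribute; a common larger bound K allows
m and n to vary. *)
Definition glued (K m n : nat) : int :=
  \sum_(j < K) \sum_(i < K)
     tri_even i j * raney_even m j * raney_even n i.

(** Multiplication by u and by w act alike on the mixed monomials, and no others
contribute since P^0 and Q^0 have no coefficient of positive degree. *)
Lemma glued_shift K m n : (m.+1 < K)%N -> (n.+1 < K)%N ->
  glued K m n.+1 = glued K m.+1 n.
Proof.
move=> ltmK ltnK.
transitivity (\sum_(j < K) \sum_(i < K)
    mul_z (tri_even i) j * raney_even m.+1 j * raney_even n.+1 i).
  rewrite /glued exchange_big [RHS]exchange_big; apply: eq_bigr => i _ /=.
  by rewrite -!mulr_suml sum_raney_even // => j; apply: tri_even_negr.
apply: eq_bigr => j _.
under [RHS]eq_bigr do rewrite mulrAC.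
rewrite -mulr_suml (sum_raney_even (f := tri_even^~ j%:Z)) //; last first.
  by move=> i; apply: tri_even_negl.
rewrite mulr_suml; apply: eq_bigr => i _.
rewrite mulrAC.
have [->|i_gt0] := posnP i; first by rewrite raney_evenS0 !mulr0 !mul0r.
have [->|j_gt0] := posnP j; first by rewrite raney_evenS0 !mulr0.
by rewrite tri_even_swap.
Qed.

Lemma glued0 K n : (n < K)%N -> glued K 0 n = (raney n 1)%:Z.
Proof.
case: K => // K ltnK; rewrite /glued big_ord_recl.
rewrite [X in _ + X]big1 => [|j _]; last first.
  by rewrite big1 // => i _; rewrite raney_even_large ?mulr0 ?mul0r.
rewrite addr0 -raney_sum (big_morph Posz PoszD (erefl _)).
rewrite (big_ord_widen K.+1 (fun i => (raney (n - i) (2 * i))%:Z)) // [RHS]big_mkcond.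
apply: eq_bigr => i _ /=; rewrite mulr1 /raney_even ltnS.
by rewrite /tri_even addr0 /tri_row tri_top mul1r.
Qed.

Lemma gluedE K m n : (m + n < K)%N -> glued K m n = (raney (m + n) 1)%:Z.
Proof.
elim: m n => [|m IHm] n ltK; first exact: glued0.
by rewrite -glued_shift ?IHm ?addnS //; lia.
Qed.

(** * Enumeration of the KT-paths to a fixed endpoint *)

Definition steps_from (u : vertex) : seq vertex :=
  let: (x, y) := u in
  if x < 0 then [:: (x + 1, y); (x, y + 2)]
  else if y < 0 then
    [seq v : vertex <- [:: (x + 2, y); (x + 1, y + 1); (x, y + 2)] | v.2 <= 0]
  else [:: (x + 2, y); (x, y + 1)].

Lemma mem_steps_from u v : (v \in steps_from u) = KT_step u v.
Proof.
case: u v => [x y] [x' y']; rewrite /steps_from /KT_step.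
rewrite -[(x, y).1]/x -[(x, y).2]/y -[(x', y').2]/y'.
have E a b : ((x', y') - (x, y) == (a, b)) = (x' == x + a) && (y' == y + b).
  by rewrite xpair_eqE /= !subr_eq ![_ + x]addrC ![_ + y]addrC.
case: ifP => _; last case: ifP => _.
- by rewrite /V2_step !inE !E !xpair_eqE !addr0.
- rewrite mem_filter -[(x', y').2]/y' /T_step.
  by rewrite !inE !E !xpair_eqE !addr0 andbC.
- by rewrite /H2_step !inE !E !xpair_eqE !addr0.
Qed.

Lemma uniq_steps_from u : uniq (steps_from u).
Proof.
case: u => x y; rewrite /steps_from; case: ifP => _; last case: ifP => _.
- by rewrite /= !inE !xpair_eqE; lia.
- by apply: filter_uniq; rewrite /= !inE !xpair_eqE; lia.
- by rewrite /= !inE !xpair_eqE; lia.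
Qed.

Definition level (u : vertex) : int := u.1 + u.2.

Lemma level_step u v : v \in steps_from u -> level u + 1 <= level v.
Proof.
case: u v => [x y] [x' y']; rewrite /steps_from /level.
case: ifP => _; last case: ifP => _; rewrite ?mem_filter /= !inE !xpair_eqE; lia.
Qed.

(** The KT-paths from u to B with at most s steps. *)
Fixpoint paths (B : vertex) (s : nat) (u : vertex) : seq (seq vertex) :=
  if u.2 <= u.1 then
    nseq (u == B) [:: u] ++
    (if s is s'.+1 then [seq u :: P | v <- steps_from u, P <- paths B s' v]
     else [::])
  else [::].

Lemma pathsE B s u : paths B s u =
  if u.2 <= u.1 then
    nseq (u == B) [:: u] ++
    (if s is s'.+1 then [seq u :: P | v <- steps_from u, P <- paths B s' v]
     else [::])
  else [::].
Proof. by case: s. Qed.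

Lemma KT_path_cons a b p :
  KT_path [:: a, b & p] = [&& a.2 <= a.1, KT_step a b & KT_path (b :: p)].
Proof. by rewrite /KT_path /=; case: (a.2 <= a.1); rewrite //= andbCA. Qed.

Lemma mem_paths B s u P :
  (P \in paths B s u) = [&& KT_path P, joins u B P & (size P <= s.+1)%N].
Proof.
have base (v : vertex) (Q : seq vertex) : (Q \in nseq (v == B) [:: v]) =
    (Q == [:: v]) && (v == B).
  by case: (v == B); rewrite /= ?inE ?andbT ?andbF.
have one a v : KT_path [:: a] && joins v B [:: a] =
    [&& v.2 <= v.1, [:: a] == [:: v] & v == B].
  rewrite /KT_path /= !andbT eqseq_cons andbT.
  by case: (a =P v) => [->|_]; rewrite ?andbF.
elim: s u P => [|s IHs] u P; rewrite pathsE.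
  case: ifP => diag_u; rewrite ?cats0 ?base.
    case: P => [|a [|b p]] //=; last by rewrite !andbF eqseq_cons andbF.
    by rewrite andbT one diag_u.
  case: P => [|a [|b p]] //; last by rewrite !andbF.
  by rewrite andbA one diag_u.
case: ifP => diag_u; last first.
  case: P => [|a p] //=; case: (a =P u) => [->|_]; last by rewrite andbF.
  by rewrite /KT_path /= diag_u.
rewrite mem_cat base.
case: P => [|a [|b p]].
- by rewrite /=; apply/negP => /allpairsPdep[v [Q []]].
- rewrite [in RHS]andbA one diag_u /= andbT; apply/orb_idr => /allpairsPdep.
  by move=> [v [[|c Q]]] [] // _; rewrite IHs.
rewrite eqseq_cons andbF /=; apply/allpairsPdep/idP.
  move=> [v [Q [v_u]]]; rewrite IHs => /and3P[KTQ jQ sQ] [-> defQ].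
  move: KTQ jQ sQ; rewrite -defQ KT_path_cons diag_u => -> /= /andP[/eqP bv ->] sp.
  by rewrite bv -mem_steps_from v_u eqxx.
rewrite KT_path_cons => /and3P[/and3P[_ st KTp] /= /andP[/eqP def_a lastB] sp].
exists b, (b :: p); split; last by rewrite def_a.
  by rewrite mem_steps_from -def_a.
by rewrite IHs KTp /= eqxx lastB.
Qed.

Lemma uniq_paths B s u : uniq (paths B s u).
Proof.
elim: s u => [|s IHs] u; rewrite pathsE; case: ifP => // _.
  by rewrite cats0; case: (u == B).
rewrite cat_uniq; apply/and3P; split; first by case: (u == B).
  apply/hasPn => P /allpairsPdep[v [[|c Q] [_]]]; first by rewrite mem_paths.
  by move=> _ ->; case: (u == B); rewrite //= inE eqseq_cons andbF.
apply: allpairs_uniq_dep => [|v _|]; [exact: uniq_steps_from | exact: IHs |].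
move=> _ _ /allpairsPdep[v [P [_ PB ->]]] /allpairsPdep[v' [P' [_ PB' ->]]] /=.
move=> [defP]; move: PB PB'; rewrite -{}defP !mem_paths.
by case: P => // c P /and3P[_ /= /andP[/eqP<- _] _] /and3P[_ /andP[/eqP<- _] _].
Qed.

Definition count_paths B s u : nat := size (paths B s u).

Lemma count_pathsS B s u : count_paths B s.+1 u =
  if u.2 <= u.1 then
    ((u == B) + \sum_(v <- steps_from u) count_paths B s v)%N
  else 0%N.
Proof.
rewrite /count_paths /=; case: ifP => // _.
by rewrite size_cat size_nseq size_allpairs_dep sumnE big_map.
Qed.

Lemma count_paths_level B s u : level B < level u -> count_paths B s u = 0%N.
Proof.
elim: s u => [|s IHs] u ltBu.
  by rewrite /count_paths /=; case: ifP => // _; case: eqP ltBu => // ->; lia.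
rewrite count_pathsS; case: ifP => // _.
case: eqP ltBu => [->|_ ltBu]; first by lia.
rewrite big_seq big1 // => v /level_step ltuv; apply: IHs; lia.
Qed.

Lemma count_paths_stable B s u :
  level B - level u <= s%:Z -> count_paths B s.+1 u = count_paths B s u.
Proof.
elim: s u => [|s IHs] u le_s.
  rewrite count_pathsS /count_paths pathsE; case: ifP => // _.
  rewrite cats0 size_nseq big_seq big1 ?addn0 // => v /level_step ltuv.
  by apply: count_paths_level; lia.
rewrite [in LHS]count_pathsS [in RHS]count_pathsS; case: ifP => // _.
congr (_ + _)%N; rewrite big_seq [RHS]big_seq.
by apply: eq_bigr => v /level_step ltuv; apply: IHs; lia.
Qed.

(** Every step raises the level by at least one, so the bound on the number of
steps excludes no path. *)
Definition num_paths (B u : vertex) : nat := count_paths B `|level B - level u| u.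

Lemma num_pathsE B s u : level B - level u <= s%:Z ->
  num_paths B u = count_paths B s u.
Proof.
move=> le_s; have [ltBu|leuB] := ltP (level B) (level u).
  by rewrite /num_paths !count_paths_level.
suff E e : count_paths B (`|level B - level u| + e) u = num_paths B u.
  rewrite -(E (s - `|level B - level u|)%N); congr count_paths; lia.
elim: e => [|e IHe]; first by rewrite addn0.
by rewrite addnS count_paths_stable ?IHe //; lia.
Qed.

Lemma num_paths_above B u : u.1 < u.2 -> num_paths B u = 0%N.
Proof. by move=> lt_u; rewrite /num_paths /count_paths pathsE leNgt lt_u. Qed.

Lemma num_paths_rec B u : u.2 <= u.1 ->
  num_paths B u = ((u == B) + \sum_(v <- steps_from u) num_paths B v)%N.
Proof.
move=> diag_u; set s := `|level B - level u|%N.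
rewrite (@num_pathsE _ s.+1) ?count_pathsS ?diag_u; last by lia.
congr (_ + _)%N; rewrite big_seq [RHS]big_seq.
by apply: eq_bigr => v /level_step ltuv; rewrite (@num_pathsE _ s) //; lia.
Qed.

Lemma num_paths_left B (x y : int) : x < 0 -> y <= x ->
  num_paths B (x, y) =
  (((x, y) == B) + num_paths B (x + 1, y)%R + num_paths B (x, y + 2)%R)%N.
Proof.
move=> x_lt0 le_yx; rewrite num_paths_rec // /steps_from x_lt0.
by rewrite !big_cons big_nil addn0 addnA.
Qed.

Lemma num_paths_up B (x y : int) : 0 <= y -> y <= x ->
  num_paths B (x, y) =
  (((x, y) == B) + num_paths B (x + 2, y)%R + num_paths B (x, y + 1)%R)%N.
Proof.
move=> y_ge0 le_yx; rewrite num_paths_rec // /steps_from !ifF; try lia.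
by rewrite !big_cons big_nil addn0 addnA.
Qed.

Lemma num_paths_quad B (x y : int) : 0 <= x -> y < 0 ->
  num_paths B (x, y) =
  (((x, y) == B) + num_paths B (x + 2, y)%R
   + (if (y + 1 <= 0)%R then num_paths B (x + 1, y + 1)%R else 0)
   + (if (y + 2 <= 0)%R then num_paths B (x, y + 2)%R else 0))%N.
Proof.
move=> x_ge0 y_lt0; rewrite num_paths_rec /=; last by lia.
rewrite ltNge x_ge0 y_lt0 /= (ltW y_lt0) big_cons -!addnA; congr (_ + (_ + _))%N.
by do 2! case: ifP => _; rewrite ?big_cons big_nil ?addn0.
Qed.

Lemma num_paths_right B u : B.1 < u.1 -> num_paths B u = 0%N.
Proof.
rewrite /num_paths; move: (`|_|)%N => s; elim: s u => [|s IHs] u ltBu.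
  rewrite /count_paths /=; case: ifP => // _.
  by case: (u =P B) ltBu => // ->; rewrite ltxx.
rewrite count_pathsS; case: ifP => // _.
case: (u =P B) ltBu => [->|_ ltBu]; first by rewrite ltxx.
rewrite big_seq big1 // => v uv; apply: IHs.
suff : u.1 <= v.1 by apply: lt_le_trans.
case: u v uv {ltBu} => [x y] [x' y']; rewrite /steps_from.
case: ifP => _; last case: ifP => _; rewrite ?mem_filter /= !inE !xpair_eqE; lia.
Qed.

Lemma size_KT_path u p : KT_path (u :: p) ->
  (size p)%:Z <= level (last u p) - level u.
Proof.
elim: p u => [|v p IHp] u /=; first by rewrite subrr.
rewrite KT_path_cons -mem_steps_from => /and3P[_ /level_step lt_uv /IHp]; lia.
Qed.

Lemma card_KT_paths A B :
  [set P : seq vertex | KT_path P /\ joins A B P] #= `I_(num_paths B A).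
Proof.
set l := paths B `|level B - level A| A.
have uniq_l : uniq l by apply: uniq_paths.
have -> : [set P : seq vertex | KT_path P /\ joins A B P] =
    [set P | P \in seq_fset tt l].
  apply/seteqP; split=> P; rewrite /mkset seq_fsetE mem_paths.
    move=> [KTP jP]; rewrite KTP jP /=.
    case: P KTP jP => // u p /size_KT_path le_p /= /andP[/eqP eqA /eqP eqB].
    move: le_p; rewrite eqB eqA ltnS -lez_nat abszE => /le_trans.
    by apply; apply: ler_norm.
  by case/and3P.
by apply/card_eq_fsetP; rewrite size_seq_fset undup_id.
Qed.

(** * Solving the recurrence in the three regions *)

(** At distance d below the diagonal and with k horizontal steps to go, the
H_2-paths satisfy the recurrence of B^(d+1). *)
Lemma num_paths_H2 (n x y : int) (k d : nat) :
  0 <= y -> x = 2 * n - 2 * k%:Z -> x = y + d%:Z ->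
  num_paths (2 * n, 2 * n) (x, y) = raney k d.+1.
Proof.
elim: k x y d => [|k IHk] x y d y_ge0 x_k.
  elim: d y y_ge0 => [|d IHd] y y_ge0 x_d; rewrite num_paths_up //; try lia.
    rewrite num_paths_right /=; last by lia.
    by rewrite num_paths_above /=; [rewrite xpair_eqE; lia | lia].
  rewrite num_paths_right /=; last by lia.
  by rewrite IHd; [rewrite xpair_eqE /=; lia | lia | lia].
elim: d y y_ge0 => [|d IHd] y y_ge0 x_d; rewrite num_paths_up //; try lia.
  rewrite (IHk _ _ 2%N) ?num_paths_above //; try (rewrite /=; lia).
  by rewrite raneySS raneyS0 xpair_eqE /=; lia.
rewrite IHd ?(IHk _ _ d.+3) //; try lia.
by rewrite [in RHS]raneySS xpair_eqE /=; lia.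
Qed.

Lemma tri_row_top (k : int) : tri_row k (2 * k) = (0 <= k).
Proof. by case: k => // k; rewrite /tri_row tri_top. Qed.

Lemma sum_tri_row_top (K n : nat) (e : int) : 0 <= e ->
  \sum_(i < K) (tri_row (i%:Z - e) (2 * i%:Z - 2 * e))%:Z * raney_even n i =
  \sum_(i < K | e <= i%:Z) raney_even n i.
Proof.
move=> e_ge0; rewrite [RHS]big_mkcond; apply: eq_bigr => i _.
by rewrite -mulrBr tri_row_top subr_ge0; case: ifP; rewrite ?mul1r ?mul0r.
Qed.

(** In the fourth quadrant, the sum is over the vertex (2i, 0) from which the path
leaves the line y = 0 upwards.  On the paths considered x + y is even, which is
why the starting point is written (x, 2e - x): then every T-step increases e by
one, and i - e of them lead to (2i, 0). *)
Lemma num_paths_T (K n : nat) (x e : int) : (n < K)%N -> 0 <= x -> 2 * e <= x ->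
  (num_paths (2 * n%:Z, 2 * n%:Z) (x, 2 * e - x))%:Z =
  \sum_(i < K) (tri_row (i%:Z - e) (2 * i%:Z - x))%:Z * raney_even n i.
Proof.
move=> ltnK; have [s] : exists s : nat, n%:Z - e < s%:Z.
  by exists (absz (n%:Z - e + 1)); lia.
elim: s x e => [|s IHs] x e lt_s x_ge0 le_ex.
  rewrite num_paths_right /=; last by lia.
  rewrite big1 // => i _; have [lt_ni|le_in] := ltnP n i.
    by rewrite raney_even_large ?mulr0.
  case def_k: (i%:Z - e) => [k|k] /=; last by rewrite mul0r.
  by lia.
(* On the line y = 0 a step to the right leaves all terms unchanged except the
   term i = e, which counts the paths that leave the line at once. *)
have [y_eq0|y_neq0] := eqVneq (2 * e) x.
  rewrite -{x}y_eq0 in x_ge0 le_ex *.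
  have e_ge0 : 0 <= e by lia.
  rewrite subrr num_paths_up; try lia.
  have := IHs (2 * e + 2) (e + 1); rewrite [2 * (e + 1) - _](_ : _ = 0); last by lia.
  rewrite !PoszD => ->; try lia.
  have -> : 2 * e + 2 = 2 * (e + 1) by lia.
  rewrite !sum_tri_row_top ?addr_ge0 //.
  case: e e_ge0 {le_ex x_ge0 IHs} lt_s => // e _ lt_s.
  have [lt_ne|le_en] := ltnP n e.
    rewrite num_paths_right /=; last by lia.
    rewrite xpair_eqE [X in (X && _)](_ : _ = false) /=; last by lia.
    by rewrite !big1 // => i le_ei; apply: raney_even_large; lia.
  have ltKe : (e < K)%N by lia.
  rewrite [RHS](bigD1 (Ordinal ltKe)) //= addrAC -!PoszD.
  congr (_ + _).
    rewrite /raney_even le_en; congr Posz.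
    case: e {lt_s ltKe} le_en => [|e] le_en.
      rewrite num_paths_above // addn0 xpair_eqE.
      by case: n {ltnK le_en} => [|n] //; rewrite raneyS0.
    rewrite (num_paths_H2 (k := n - e.+1) (d := (2 * e).+1)); try lia.
    rewrite xpair_eqE (_ : _ && _ = false); last by lia.
    by rewrite add0n; congr raney; lia.
  by apply: eq_bigl => i; rewrite -val_eqE /=; lia.
rewrite num_paths_quad; try lia.
have := IHs (x + 2) (e + 1); have := IHs (x + 1) (e + 1); have := IHs x (e + 1).
have -> : 2 * (e + 1) - x = 2 * e - x + 2 by lia.
have -> : 2 * (e + 1) - (x + 1) = 2 * e - x + 1 by lia.
have -> : 2 * (e + 1) - (x + 2) = 2 * e - x by lia.
move=> E0 E1 E2; rewrite !PoszD E2; try lia.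
rewrite ifT ?E1; try lia.
(* For y = -1 the step (0, 2) is forbidden, and the sum that it would contribute
   vanishes. *)
have -> : Posz (if 2 * e - x + 2 <= 0 then
    num_paths (2 * n%:Z, 2 * n%:Z) (x, 2 * e - x + 2)%R else 0) =
    \sum_(i < K) (tri_row (i%:Z - (e + 1)) (2 * i%:Z - x))%:Z * raney_even n i.
  case: ifP => [y_le|y_gt]; first by apply: E0; lia.
  by rewrite big1 // => i _; rewrite tri_row_large ?mul0r //; lia.
rewrite xpair_eqE [X in (_ && X)](_ : _ = false) ?andbF ?add0r; last by lia.
rewrite -!big_split; apply: eq_bigr => i _ /=; rewrite -!mulrDl; congr (_ * _).
have [-> |ne_ie] := eqVneq (i%:Z) e.
  have -> : e - (e + 1) = -1 by lia.
  by rewrite subrr tri_row_small //; lia.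
rewrite (@tri_rowS (i%:Z - e)); last by lia.
have -> : i%:Z - (e + 1) = i%:Z - e - 1 by lia.
have -> : 2 * i%:Z - (x + 1) = 2 * i%:Z - x - 1 by lia.
have -> : 2 * i%:Z - (x + 2) = 2 * i%:Z - x - 2 by lia.
by rewrite !PoszD; ring.
Qed.

(** * Crossing the left half plane *)

(** The number of V_2-paths that start on the diagonal, stay below it, and reach
for the first time the column at distance r to the right after k vertical steps.
The reflection in the antidiagonal turns them into H_2-paths that end on the
diagonal and start at distance r - 2k from it, with a vertical step when r > 0;
hence the power B^(r - 2k) instead of B^(r - 2k + 1). *)
Definition arrivals (r k : nat) : nat :=
  if (2 * k <= r)%N then raney k (r - 2 * k) else 0.

Lemma arrivals0 r : arrivals r 0 = 1%N. Proof. by []. Qed.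

Lemma arrivals_above r k : (r < 2 * k)%N -> arrivals r.+1 k = 0%N.
Proof.
rewrite /arrivals; case: k => // k lt_rk; case: ifP => // le_kr.
by rewrite (_ : (_ - _)%N = 0%N) ?raneyS0 //; lia.
Qed.

Lemma arrivalsS r k : (2 * k.+1 <= r)%N ->
  arrivals r.+1 k.+1 = (arrivals r k.+1 + arrivals r.+1 k)%N.
Proof.
move=> le_kr; rewrite /arrivals !ifT; try lia.
rewrite subSn // raneySS; congr (_ + raney _ _)%N; lia.
Qed.

(** A KT-path that starts in the left half plane is classified by the vertex at
which it first reaches a given column. *)
Lemma num_paths_column (B : vertex) (m r : nat) :
  (r <= 2 * m)%N -> - (2 * m%:Z) + r%:Z <= B.1 ->
  num_paths B (- (2 * m%:Z), - (2 * m%:Z)) =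
  (\sum_(k < m.+1)
     arrivals r k * num_paths B (- (2 * m%:Z) + r%:Z, - (2 * m%:Z) + 2 * k%:Z)%R)%N.
Proof.
elim: r => [|r IHr] le_rm le_rB.
  by rewrite big_ord_recl big1 ?addn0 ?mul1n ?mulr0 ?addr0.
rewrite {}IHr; try lia.
set x := - (2 * m%:Z) + r%:Z.
pose y (k : nat) := - (2 * m%:Z) + 2 * k%:Z.
rewrite (_ : - (2 * m%:Z) + r.+1%:Z = x + 1); last by rewrite /x; lia.
pose w k := num_paths B (x, y k); rewrite -!/(y _).
have w_above k : (r < 2 * k)%N -> w k = 0%N.
  by move=> lt_rk; apply: num_paths_above; rewrite /x /y /=; lia.
(* By [arrivalsS], [arrivals r.+1 k] also counts all visits to height k in
   column r: by a first arrival there, or by a vertical step from k - 1. *)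
suff E : (\sum_(k < m.+1) arrivals r.+1 k * w k =
          \sum_(k < m.+1) arrivals r k * w k +
          \sum_(k < m.+1) arrivals r.+1 k * w k.+1)%N.
  apply/eqP; rewrite -(eqn_add2r (\sum_(k < m.+1) arrivals r.+1 k * w k.+1)%N).
  rewrite -E -big_split; apply/eqP/eq_bigr => k _ /=; rewrite -mulnDr.
  have [le_kr|lt_rk] := leqP (2 * k) r; last by rewrite arrivals_above ?mul0n.
  congr (_ * _)%N; rewrite /w (@num_paths_left B x (y k)); try (rewrite /x /y; lia).
  case: eqP => [def_B|_]; first by move: le_rB; rewrite -def_B /= /x; lia.
  by congr (_ + num_paths _ (_, _))%N; rewrite /y; lia.
rewrite [LHS]big_ord_recl [X in _ = (X + _)%N]big_ord_recl.
rewrite [X in _ = (_ + X)%N]big_ord_recr /=.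
rewrite (w_above m.+1); last by lia.
rewrite muln0 addn0 !arrivals0 -!addnA; congr (_ + _)%N.
rewrite -big_split; apply: eq_bigr => k _; rewrite /= /bump add1n -mulnDl.
have [le_kr|lt_rk] := leqP (2 * k.+1) r; last by rewrite w_above ?muln0.
by rewrite arrivalsS.
Qed.

(** In the column of the endpoint only vertical steps remain. *)
Lemma num_paths_end_column (c : int) (l : nat) : 2 * c < 0 ->
  num_paths (2 * c, 2 * c) (2 * c, 2 * c - 2 * l%:Z) = 1%N.
Proof.
move=> c_lt0; elim: l => [|l IHl].
  rewrite mulr0 subr0 num_paths_left // eqxx num_paths_right /=; last by lia.
  by rewrite num_paths_above //=; lia.
rewrite num_paths_left //; last by lia.
rewrite num_paths_right /=; last by lia.
rewrite (_ : _ + 2 = 2 * c - 2 * l%:Z) ?IHl; last by lia.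
by rewrite xpair_eqE; lia.
Qed.

(** * The theorem *)

Theorem theorem7p6 (m n : int) (hmn : 0 <= m + n) :
  [set P : seq vertex | KT_path P
     /\ joins (- (2 * m), - (2 * m)) (2 * n, 2 * n) P]
    #= `I_(fuss_catalan `|(m + n)%R|%N).
Proof.
suff <- : num_paths (2 * n, 2 * n) (- (2 * m), - (2 * m)) =
    fuss_catalan `|(m + n)%R|%N by apply: card_KT_paths.
rewrite -raney1.
have [m_le0|m_gt0] := lerP m 0.
  by apply: num_paths_H2; lia.
case: m m_gt0 hmn => // m m_gt0 hmn.
have [n_lt0|n_ge0] := ltP n 0.
  set N := absz (m%:Z + n).
  have le_Nm : (N < m.+1)%N by lia.
  rewrite (@num_paths_column _ _ (2 * N)); try (rewrite /=; lia).
  transitivity (\sum_(k < N.+1) raney k (2 * N - 2 * k)).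
    rewrite (big_ord_widen m.+1 (fun k => raney k (2 * N - 2 * k))) //.
    rewrite [RHS]big_mkcond.
    apply: eq_bigr => k _ /=; rewrite /arrivals leq_mul2l ltnS.
    case: leqP => [le_kN|_]; last by rewrite mul0n.
    rewrite (_ : - (2 * m%:Z) + (2 * N)%:Z = 2 * n); last by lia.
    rewrite (_ : - (2 * m%:Z) + 2 * k%:Z = 2 * n - 2 * (N - k)%:Z); last by lia.
    by rewrite num_paths_end_column ?muln1 //; lia.
  rewrite -raney_sum (reindex_inj rev_ord_inj) /=.
  by apply: eq_bigr => k _; have := ltn_ord k => lt_kN; congr raney; lia.
case: n n_ge0 hmn => // n _ _.
set K := (m + n).+1.
rewrite (@num_paths_column _ _ (2 * m)); try (rewrite /=; lia).
apply/eqP; rewrite -eqz_nat; apply/eqP.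
rewrite (_ : `|_|%N = (m + n)%N) // -(@gluedE K) // /glued.
rewrite (reindex_inj rev_ord_inj) (big_morph Posz PoszD (erefl _)) /=.
pose F j := (arrivals (2 * m) (m.+1 - j.+1) * num_paths (2 * n%:Z, 2 * n%:Z)%R
  (- (2 * m%:Z) + (2 * m)%:Z, - (2 * m%:Z) + 2 * (m.+1 - j.+1)%:Z)%R)%N.
rewrite (big_ord_widen K (fun j => (F j)%:Z)); last by rewrite /K; lia.
rewrite [LHS]big_mkcond; apply: eq_bigr => j _; rewrite /F ltnS.
have [le_jm|lt_mj] := leqP j m; last first.
  by rewrite big1 // => i _; rewrite raney_even_large // mulr0 mul0r.
rewrite (_ : - (2 * m%:Z) + (2 * m)%:Z = 0); last by lia.
rewrite (_ : _ + _ = 2 * (- j%:Z) - 0); last by lia.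
rewrite PoszM (@num_paths_T K); try (rewrite /K; lia).
rewrite mulr_sumr; apply: eq_bigr => i _.
rewrite /tri_even /raney_even le_jm /arrivals ifT; last by lia.
rewrite (_ : (2 * m - _)%N = (2 * j)%N); last by lia.
by rewrite subSS opprK subr0; ring.
Qed.
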